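(* For any $\lambda>0$ there is $c>0$ such that the following holds. For $i\in[n]$ let $T_i$ be a Markov chain on a finite set $\Omega_i$ with stationary distribution $\nu_i$ and absolute spectral gap $\lambda_*(T_i)\ge\lambda$; let $T$ be the product chain on $\Omega=\prod_i\Omega_i$, with stationary distribution $\nu=\prod_i\nu_i$, and let $x,y$ be consecutive random states of the stationary chain for $T$ (i.e. $x\sim\nu$ and $y$ is obtained from $x$ by one step of $T$). If $\mathcal{F}\subset\Omega$ is $(\log(1/\mu),\mu^{1-c})$-global with $\mu\in(0,1/16)$, then $\Pr(x\in\mathcal{F},y\in\mathcal{F})\le\mu^{1+c}$.
   Context: The product chain has transition probabilities $T_{xy}=\prod_{i}(T_i)_{x_iy_i}$. The absolute spectral gap $\lambda_*(T_i)$ is defined by $(1-\lambda_* )^2=\sup\{\mathbb{E}_{\nu_i}[(T_if)^2]: \mathbb{E}_{\nu_i}f=0,\ \mathbb{E}_{\nu_i}f^2=1\}$, where $(T_if)(a)=\sum_b(T_i)_{ab}f(b)$. For $R\subset[n]$ and $a\in\Omega_R=\prod_{i\in R}\Omega_i$, the restriction $f_{R\to a}$ of $f:\Omega\to\mathbb{R}$ is the function on $\Omega_{[n]\setminus R}$ obtained by fixing the coordinates in $R$ to $a$. A function $f$ is $(r,\varepsilon)$-global if $\|f_{R\to a}\|_2^2\le\varepsilon$ for all $R$ with $|R|\le r$ and all $a\in\Omega_R$ (norms with respect to the product of the $\nu_i$, $i\notin R$); a set is $(r,\varepsilon)$-global if its indicator function is. *)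

(* Defs.v *)
From HB Require Import structures.
From mathcomp Require Import all_boot all_order all_algebra.
From mathcomp Require Import all_classical all_reals.
From mathcomp Require Import ereal sequences exp.
Set Implicit Arguments. Unset Strict Implicit. Unset Printing Implicit Defensive.
Import Order.TTheory GRing.Theory Num.Theory.
Local Open Scope ring_scope.

Section Defs.
Variable R : realType.

Definition Ev (S : finType) (nu : S -> R) (f : S -> R) : R :=
  \sum_(a : S) nu a * f a.

Definition markov_chain (S : finType) (P : S -> S -> R) : Prop :=
  (forall a b, 0 <= P a b) /\ (forall a, \sum_(b : S) P a b = 1).

Definition distribution (S : finType) (nu : S -> R) : Prop :=
  (forall a, 0 <= nu a) /\ \sum_(a : S) nu a = 1.

Definition stationary_dist (S : finType) (P : S -> S -> R) (nu : S -> R) : Prop :=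
  distribution nu /\ (forall b, \sum_(a : S) nu a * P a b = nu b).

Definition applyP (S : finType) (P : S -> S -> R) (f : S -> R) : S -> R :=
  fun a => \sum_(b : S) P a b * f b.

Definition one_minus_gap_sq (S : finType) (P : S -> S -> R) (nu : S -> R) : \bar R :=
  ereal_sup [set (Ev nu (fun a => applyP P f a ^+ 2))%:E
            | f in [set f : S -> R | Ev nu f = 0 /\ Ev nu (fun a => f a ^+ 2) = 1]].

(** lambda_*(P) >= lam, where lambda_*(P) = 1 - sqrt(one_minus_gap_sq P nu)
    (sqrt >= 0); i.e. sqrt(sup) <= 1 - lam. *)
Definition abs_spectral_gap_ge (S : finType) (P : S -> S -> R) (nu : S -> R)
  (lam : R) : Prop :=
  0 <= 1 - lam /\ (one_minus_gap_sq P nu <= ((1 - lam) ^+ 2)%:E)%E.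

Definition prodT (n : nat) (Om : 'I_n -> finType) : finType :=
  {dffun forall i : 'I_n, Om i}.

Definition prod_chain n (Om : 'I_n -> finType) (T : forall i, Om i -> Om i -> R)
  (x y : prodT Om) : R := \prod_(i : 'I_n) T i (x i) (y i).

Definition prod_dist n (Om : 'I_n -> finType) (nu : forall i, Om i -> R)
  (x : prodT Om) : R := \prod_(i : 'I_n) nu i (x i).

(** ||f_{R -> a}||_2^2 : the point a in Omega_R is encoded by any full point
    a : Omega (only its coordinates in R matter); the points of
    Omega_{[n]\R} are encoded by the w : Omega agreeing with a on R. *)
Definition restr_sqnorm n (Om : 'I_n -> finType) (nu : forall i, Om i -> R)
  (Rs : {set 'I_n}) (a : prodT Om) (f : prodT Om -> R) : R :=
  \sum_(w : prodT Om | [forall i in Rs, w i == a i])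
     (\prod_(i | i \notin Rs) nu i (w i)) * f w ^+ 2.

Definition is_global n (Om : 'I_n -> finType) (nu : forall i, Om i -> R)
  (r eps : R) (f : prodT Om -> R) : Prop :=
  forall (Rs : {set 'I_n}) (a : prodT Om), (#|Rs|%:R <= r) ->
    restr_sqnorm nu Rs a f <= eps.

Definition indic n (Om : 'I_n -> finType) (F : {set prodT Om}) : prodT Om -> R :=
  fun x => (x \in F)%:R.

Definition edge_prob n (Om : 'I_n -> finType) (T : forall i, Om i -> Om i -> R)
  (nu : forall i, Om i -> R) (F : {set prodT Om}) : R :=
  \sum_(x in F) \sum_(y in F) prod_dist nu x * prod_chain T x y.

End Defs.

(* Main.v *)
Require Import Defs.
From HB Require Import structures.
From mathcomp Require Import all_boot all_order all_algebra.
From mathcomp Require Import all_classical all_reals.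
From mathcomp Require Import ereal sequences exp.
From mathcomp Require Import ring lra.
Import Order.TTheory GRing.Theory Num.Theory.
Local Open Scope ring_scope.
Set Implicit Arguments. Unset Strict Implicit. Unset Printing Implicit Defensive.

(* Write [E_i] for averaging over coordinate [i], [L_i = 1 - E_i] and
   [N_t = prod_i (E_i + t L_i)].  The [T_i] commute with the averages over the
   other coordinates, so the spectral gap gives [|T f| <= |N_rho f|] with
   [rho = 1 - lambda], and Cauchy-Schwarz [|N_t f|^2 = <f, N_(t^2) f>
   <= |f| |N_(t^2) f|] reduces the claim to [|N_(1/4) f|^2 <= eps^(4/3)], where
   [eps = mu^(1-c)] and [f] is the indicator function.

   That bound follows by Hoelder's inequality from
   [E (N_(1/16) f)^4 <= eps E (N_(1/4) f)^2].  Tensorising a one-coordinate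
   inequality gives [E (N_(1/2) g)^4 <= sum_S E (E_(~S) (L_S g)^2)^2].  For
   [g = N_(1/8) f], the inner average is at most [16^-|S|] times the largest
   [|f_(J -> x)|^2] with [J] a subset of [S]; this is at most [eps] by
   globalness when [|S| <= log(1/mu)], and because [16^-|S| <= mu] otherwise.
   So no truncation in degree is needed. *)

(** * Operators acting on one coordinate of a product space *)

Section Kernels.
Variables (R : realType) (n : nat) (Om : 'I_n -> finType).
Implicit Types (u v : prodT Om -> R) (x w : prodT Om) (i j : 'I_n).
Implicit Types (s : seq 'I_n) (K : forall i, Om i -> Om i -> R).

Definition upd x i (b : Om i) : prodT Om := [ffun j => eqtype.dfwith x b j].

Lemma upd_in x i (b : Om i) : upd x b i = b.
Proof. by rewrite ffunE eqtype.dfwith_in. Qed.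

Lemma upd_out x i (b : Om i) j : i != j -> upd x b j = x j.
Proof. by move=> ij; rewrite ffunE eqtype.dfwith_out. Qed.

Lemma updC x i j (b : Om i) (d : Om j) : i != j ->
  upd (upd x b) d = upd (upd x d) b.
Proof.
move=> ij; apply/ffunP => k.
have [kj|kj] := eqVneq j k.
  by case: _ / kj; rewrite upd_in upd_out// upd_in.
have [ki|ki] := eqVneq i k.
  by case: _ / ki kj => kj; rewrite upd_out// !upd_in.
by rewrite !upd_out.
Qed.

Lemma updK x i (b d : Om i) : upd (upd x b) d = upd x d.
Proof.
apply/ffunP => k; have [ki|ki] := eqVneq i k.
  by case: _ / ki; rewrite !upd_in.
by rewrite !upd_out.
Qed.

(** Averages (rows all equal to [nu]) and single-coordinate chain steps are both instances, so
    commutation and the expansion into a sum over states are proved once for both. *)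
Definition kop K i u x := \sum_b K i (x i) b * u (upd x b).

Lemma kopC K K' i j u : i != j -> kop K i (kop K' j u) = kop K' j (kop K i u).
Proof.
move=> ij; apply/funext => x; rewrite /kop.
under eq_bigr do rewrite mulr_sumr.
rewrite exchange_big; apply: eq_bigr => b _.
rewrite mulr_sumr; apply: eq_bigr => d _.
rewrite !upd_out// 1?eq_sym// (updC x d b)//; ring.
Qed.

Lemma foldr_kopE K s u x : uniq s ->
  foldr (kop K) u s x =
  \sum_(w : prodT Om | [forall i, (i \notin s) ==> (w i == x i)])
     (\prod_(i <- s) K i (x i) (w i)) * u w.
Proof.
elim: s x => [|i s IH] x /=.
  move=> _; rewrite (big_pred1 x) ?big_nil ?mul1r// => w /=.
  apply/forallP/eqP => [h|-> j//].
  by apply/ffunP => j; apply/eqP/h.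
move=> /andP[is_ us].
under [LHS]eq_bigr => b _ do rewrite IH// mulr_sumr big_mkcond.
rewrite exchange_big [RHS]big_mkcond; apply: eq_bigr => w _.
(* For fixed [w] only [b = w i] survives: as [i] is not in [s], [w] must agree with [upd x b] at
   [i]. *)
rewrite (bigD1 (w i))//= [X in _ + X]big1 ?addr0; last first.
  move=> b bw; case: ifP => // /forallP/(_ i); rewrite is_/= upd_in.
  by rewrite eq_sym (negPf bw).
have -> : [forall j, (j \notin s) ==> (w j == upd x (w i) j)] =
          [forall j, (j \notin i :: s) ==> (w j == x j)].
  apply: eq_forallb => j; rewrite inE negb_or.
  have [->|ji] := eqVneq j i; first by rewrite upd_in eqxx implybT.
  by rewrite upd_out// eq_sym.
case: ifP => // _; rewrite big_cons mulrA; congr (_ * _ * _).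
apply: eq_big_seq => j js; rewrite upd_out//.
by apply: contraNneq is_ => ->.
Qed.

End Kernels.

(** * Conditional averages and noise operators *)

Section Averages.
Variables (R : realType) (n : nat) (Om : 'I_n -> finType).
Variables (nu : forall i, Om i -> R).
Hypothesis nuP : forall i, distribution (@nu i).
Implicit Types (u v : prodT Om -> R) (x w : prodT Om) (i j : 'I_n).
Implicit Types (s : seq 'I_n).

Definition ave i u x := \sum_b nu b * u (upd x (b : Om i)).

(** This is [a E_i + b L_i]: [dil 0 1 i] is the Laplacian [L_i], and [dil 1 t i] is one factor of
    the noise operator. *)
Definition dil (a b : R) i u x := a * ave i u x + b * (u x - ave i u x).

(** The result stays a function on the whole space, constant in the coordinates of [s]; thus [Es A]
    of [f ^+ 2] at [x] is the squared norm of [f] with the coordinates outside [A] fixed to those of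
    [x]. *)
Definition Es s u := foldr ave u s.

Definition noise t s u := foldr (dil 1 t) u s.

Lemma Es_cons i s u : Es (i :: s) u = ave i (Es s u).
Proof. by []. Qed.

Lemma ave_kop i : ave i = kop (fun j (_ : Om j) => @nu j) i.
Proof. by []. Qed.

Lemma aveD i u v x : ave i (fun y => u y + v y) x = ave i u x + ave i v x.
Proof. by rewrite /ave -big_split; apply: eq_bigr => b _; rewrite mulrDr. Qed.

Lemma aveZ i a u x : ave i (fun y => a * u y) x = a * ave i u x.
Proof. by rewrite /ave mulr_sumr; apply: eq_bigr => b _; rewrite mulrCA. Qed.

Lemma ave_upd i u x (b : Om i) : ave i u (upd x b) = ave i u x.
Proof. by apply: eq_bigr => d _; rewrite updK. Qed.

(** The factor [ave i v] does not depend on coordinate [i], so it leaves the average. *)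
Lemma ave_mulr i u v x :
  ave i (fun y => u y * ave i v y) x = ave i u x * ave i v x.
Proof.
rewrite {1}/ave mulr_suml; apply: eq_bigr => b _.
by rewrite ave_upd mulrA.
Qed.

Lemma ave_cst i a x : ave i (fun=> a) x = a.
Proof. by rewrite /ave -mulr_suml (nuP i).2 mul1r. Qed.

Lemma ave_idem i u : ave i (ave i u) = ave i u.
Proof.
apply/funext => x; under [LHS]eq_bigr do rewrite ave_upd.
exact: ave_cst.
Qed.

Lemma aveC i j u : ave i (ave j u) = ave j (ave i u).
Proof. by have [->//|ij] := eqVneq i j; rewrite !ave_kop kopC. Qed.

Lemma ave_le i u v : (forall x, u x <= v x) -> forall x, ave i u x <= ave i v x.
Proof.
by move=> uv x; apply: ler_sum => b _; rewrite ler_wpM2l ?(nuP i).1.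
Qed.

Lemma Es_lin s a b u v x :
  Es s (fun y => a * u y + b * v y) x = a * Es s u x + b * Es s v x.
Proof.
elim: s x => // i s IH x; rewrite !Es_cons.
by under [Es s _]funext do rewrite IH; rewrite aveD !aveZ.
Qed.

Lemma EsZ s a u x : Es s (fun y => a * u y) x = a * Es s u x.
Proof.
have := Es_lin s a 0 u u x; rewrite mul0r addr0 => <-; congr (Es s _ x).
by apply/funext => y; rewrite mul0r addr0.
Qed.

Lemma EsD s u v x : Es s (fun y => u y + v y) x = Es s u x + Es s v x.
Proof.
have := Es_lin s 1 1 u v x; rewrite !mul1r => <-; congr (Es s _ x).
by apply/funext => y; rewrite !mul1r.
Qed.

Lemma Es_cst s a x : Es s (fun=> a) x = a.
Proof.
elim: s x => // i s IH x; rewrite Es_cons.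
by under [Es s _]funext do rewrite IH; rewrite ave_cst.
Qed.

Lemma Es_le s u v : (forall x, u x <= v x) -> forall x, Es s u x <= Es s v x.
Proof. by move=> uv; elim: s => // i s IH; exact: ave_le. Qed.

Lemma Es_ge0 s u : (forall x, 0 <= u x) -> forall x, 0 <= Es s u x.
Proof. by move=> u0 x; rewrite -(Es_cst s 0 x); exact: Es_le. Qed.

Lemma Es_ave s i u : Es s (ave i u) = ave i (Es s u).
Proof. by elim: s => // j s IH; rewrite !Es_cons IH aveC. Qed.

Lemma Es_mem s i u : i \in s -> Es s (ave i u) = Es s u.
Proof.
rewrite Es_ave; elim: s => // j s IH; rewrite inE Es_cons => /orP[/eqP->|js].
  by rewrite ave_idem.
by rewrite aveC IH.
Qed.

Lemma Es_cat s t u : Es (s ++ t) u = Es s (Es t u).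
Proof. by rewrite /Es foldr_cat. Qed.

Lemma Es_undup s u : Es (undup s) u = Es s u.
Proof.
elim: s => //= i s IH; case: ifP => [is_|_]; last by rewrite /= IH.
by rewrite IH -Es_ave Es_mem.
Qed.

Lemma CauchySchwarz_Es s u v x :
  Es s (fun y => u y * v y) x ^+ 2 <=
  Es s (fun y => u y ^+ 2) x * Es s (fun y => v y ^+ 2) x.
Proof.
set X := Es s (fun y => u y ^+ 2) x; set Z := Es s (fun y => v y ^+ 2) x.
set Y := Es s _ x.
(* The average of the square of [a u + b v] is a nonnegative quadratic form in [a], [b]. Taking
   [(Z, -Y)] gives [Z (X Z - Y ^+ 2) >= 0], which settles [Z > 0]; the case [X > 0] is symmetric,
   and if both vanish then [(1, 1)] and [(1, -1)] force [Y = 0]. *)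
have quad a b : 0 <= a ^+ 2 * X + b ^+ 2 * Z + a * b * 2 * Y.
  have : 0 <= Es s (fun y => (a * u y + b * v y) ^+ 2) x.
    by apply: Es_ge0 => y; exact: sqr_ge0.
  rewrite (_ : (fun y => _) = fun y => 1 * (a ^+ 2 * u y ^+ 2 + b ^+ 2 * v y ^+ 2)
    + (a * b * 2) * (u y * v y)); last by apply/funext => y; ring.
  by rewrite Es_lin Es_lin mul1r.
have X0 : 0 <= X by apply: Es_ge0 => y; exact: sqr_ge0.
have Z0 : 0 <= Z by apply: Es_ge0 => y; exact: sqr_ge0.
have [Zp|Z_] := ltrP 0 Z.
  rewrite -subr_ge0 -(pmulr_rge0 _ Zp).
  have := quad Z (- Y); congr (0 <= _); ring.
have Ze : Z = 0 by apply/le_anti; rewrite Z_ Z0.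
have [Xp|X_] := ltrP 0 X.
  rewrite -subr_ge0 -(pmulr_rge0 _ Xp).
  have := quad (- Y) X; congr (0 <= _); ring.
have Xe : X = 0 by apply/le_anti; rewrite X_ X0.
have := quad 1 1; have := quad 1 (-1); rewrite Xe Ze => h1 h2.
have -> : Y = 0 by lra.
by rewrite expr0n mulr0.
Qed.

Lemma dilE a b i u x : dil a b i u x = b * u x + (a - b) * ave i u x.
Proof. by rewrite /dil; ring. Qed.

Lemma ave_dil a b i j u x :
  ave i (dil a b j u) x = dil a b j (ave i u) x.
Proof.
rewrite dilE (_ : dil a b j u = fun y => b * u y + (a - b) * ave j u y).
  by rewrite aveD !aveZ aveC.
by apply/funext => y; rewrite dilE.
Qed.

Lemma dilC a b c d i j u :
  dil a b i (dil c d j u) = dil c d j (dil a b i u).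
Proof.
apply/funext => x; rewrite !(dilE _ _ _ _ x) !ave_dil !dilE aveC; ring.
Qed.

(** [E_i] and [L_i] are complementary projections, so the coefficients multiply. *)
Lemma dil_dil a b c d i u : dil a b i (dil c d i u) = dil (a * c) (b * d) i u.
Proof.
apply/funext => x; rewrite !(dilE _ _ _ _ x) ave_dil !dilE ave_idem; ring.
Qed.

Lemma foldr_dilC a b c d s i u :
  foldr (dil a b) (dil c d i u) s = dil c d i (foldr (dil a b) u s).
Proof. by elim: s => //= j s ->; rewrite dilC. Qed.

Lemma noise_dil t s c d i u :
  noise t s (dil c d i u) = dil c d i (noise t s u).
Proof. exact: foldr_dilC. Qed.

Lemma noise_noise t t' s u :
  noise t s (noise t' s u) = noise (t * t') s u.
Proof.
elim: s u => //= i s IH u.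
by rewrite noise_dil IH dil_dil mulr1.
Qed.

(* Orthogonality of [ave i u] and [u - ave i u], conditionally on the
   coordinates outside a set of coordinates containing [i]. *)
Lemma Es_dil_sqr s a b i u x : i \in s ->
  Es s (fun y => dil a b i u y ^+ 2) x =
  a ^+ 2 * Es s (fun y => ave i u y ^+ 2) x +
  b ^+ 2 * Es s (fun y => dil 0 1 i u y ^+ 2) x.
Proof.
(* As [i] lies in [s], an extra [ave i] can be inserted under [Es s]; this leaves an identity in the
   single coordinate [i]. *)
move=> is_; rewrite -!EsZ -EsD -(Es_mem _ is_).
rewrite -[RHS](congr1 (fun f => f x) (Es_mem _ is_)).
congr (Es s _ x); apply/funext => {}x.
have e1 : ave i (fun y => ave i u y ^+ 2) x = ave i u x ^+ 2.
  by rewrite (ave_mulr i (ave i u) u) ave_idem.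
have e2 : ave i (fun y => u y * ave i u y) x = ave i u x ^+ 2.
  by rewrite ave_mulr.
set U := ave i (fun y => u y ^+ 2) x.
have sq c d : ave i (fun y => dil c d i u y ^+ 2) x =
    d ^+ 2 * U + (c ^+ 2 - d ^+ 2) * ave i u x ^+ 2.
  rewrite (_ : (fun y => _) = fun y => d ^+ 2 * u y ^+ 2 +
    (2 * d * (c - d) * (u y * ave i u y) + (c - d) ^+ 2 * ave i u y ^+ 2)).
    by rewrite !aveD !aveZ e1 e2 -/U; ring.
  by apply/funext => y; rewrite dilE; ring.
by rewrite aveD !aveZ !sq e1; ring.
Qed.

End Averages.

(** * Hypercontractivity through restrictions and Laplacians *)

Section Hypercontractivity.
Variables (R : realType) (n : nat) (Om : 'I_n -> finType).
Variables (nu : forall i, Om i -> R).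
Hypothesis nuP : forall i, distribution (@nu i).
Variable x0 : prodT Om.
Implicit Types (u v f g : prodT Om -> R) (x w : prodT Om) (i j : 'I_n).
Implicit Types (s A S : seq 'I_n).

Local Notation ave := (ave nu).
Local Notation dil := (dil nu).
Local Notation Es := (Es nu).
Local Notation noise := (noise nu).

(** Averaging over every coordinate gives a constant function; its value is read at the base point
    [x0]. *)
Definition Etot u := Es (enum 'I_n) u x0.
Local Notation E := Etot.

Lemma Etot_le u v : (forall x, u x <= v x) -> E u <= E v.
Proof. by move=> uv; apply: Es_le. Qed.

Lemma Etot_ge0 u : (forall x, 0 <= u x) -> 0 <= E u.
Proof. by move=> u0; apply: Es_ge0. Qed.

Lemma EtotD u v : E (fun y => u y + v y) = E u + E v.
Proof. exact: EsD. Qed.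

Lemma EtotZ a u : E (fun y => a * u y) = a * E u.
Proof. exact: EsZ. Qed.

Lemma Etot_ave i u : E (ave i u) = E u.
Proof. by rewrite /E Es_mem ?mem_enum. Qed.

Lemma Etot_Es A u : E (Es A u) = E u.
Proof. by elim: A => // i A IH; rewrite Es_cons Etot_ave. Qed.

Lemma Etot_dil_sqr a b i u :
  E (fun y => dil a b i u y ^+ 2) =
  a ^+ 2 * E (fun y => ave i u y ^+ 2) +
  b ^+ 2 * E (fun y => dil 0 1 i u y ^+ 2).
Proof. by apply: Es_dil_sqr; rewrite ?mem_enum. Qed.

Lemma Etot_mul_ave i u v :
  E (fun y => u y * ave i v y) = E (fun y => ave i u y * ave i v y).
Proof.
rewrite -(Etot_ave i); congr E; apply/funext => x; exact: ave_mulr.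
Qed.

(** Self-adjointness, inherited from the orthogonal projection [ave i]. *)
Lemma Etot_dil_adj a b i u v :
  E (fun y => dil a b i u y * v y) = E (fun y => u y * dil a b i v y).
Proof.
have -> : (fun y => dil a b i u y * v y) =
    fun y => b * (u y * v y) + (a - b) * (v y * ave i u y).
  by apply/funext => y; rewrite dilE; ring.
have -> : (fun y => u y * dil a b i v y) =
    fun y => b * (u y * v y) + (a - b) * (u y * ave i v y).
  by apply/funext => y; rewrite dilE; ring.
rewrite !EtotD !EtotZ (Etot_mul_ave i u v) (Etot_mul_ave i v u); congr (_ + _ * E _).
by apply/funext => y; rewrite mulrC.
Qed.

Lemma Etot_noise_adj t s u v :
  E (fun y => noise t s u y * v y) = E (fun y => u y * noise t s v y).
Proof.
elim: s u v => // i s IH u v.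
rewrite -[noise t (i :: s) u]/(dil 1 t i (noise t s u)) Etot_dil_adj IH.
by rewrite noise_dil.
Qed.

Lemma Etot_noise_sqr t s u :
  E (fun y => noise t s u y ^+ 2) = E (fun y => u y * noise (t * t) s u y).
Proof. by rewrite -noise_noise// -Etot_noise_adj. Qed.

(** The parameter is changed one coordinate at a time; by orthogonality only the weight of the
    Laplacian part grows. *)
Lemma noise_sqr_mono (t t' : R) s u : 0 <= t <= t' ->
  E (fun y => noise t s u y ^+ 2) <= E (fun y => noise t' s u y ^+ 2).
Proof.
move=> /andP[t0 tt']; have t'0 := le_trans t0 tt'; elim: s u => // i s IH u.
rewrite /= -/(noise t s u) -/(noise t' s u).
apply: (@le_trans _ _ (E (fun y => dil 1 t' i (noise t s u) y ^+ 2))).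
  rewrite (Etot_dil_sqr 1 t) (Etot_dil_sqr 1 t') lerD2l ler_wpM2r ?lerXn2r//.
  by apply: Etot_ge0 => y; exact: sqr_ge0.
by rewrite -!noise_dil; exact: IH.
Qed.

(** One-coordinate inequality with the other averages [Es A] carried along: coordinate [i] is either
    added to the averaged ones or hit by its Laplacian. *)
Lemma hypercontractive_step A i g :
  E (fun y => Es A (fun z => dil 1 (1 / 2) i g z ^+ 2) y ^+ 2) <=
  E (fun y => Es (i :: A) (fun z => g z ^+ 2) y ^+ 2) +
  E (fun y => Es A (fun z => dil 0 1 i g z ^+ 2) y ^+ 2).
Proof.
set L := dil 0 1 i g.
set X := Es A (fun z => ave i g z ^+ 2).
set Y := Es A (fun z => L z * ave i g z).
set Z := Es A (fun z => L z ^+ 2).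
set W := ave i Z.
have LE y : L y = g y - ave i g y by rewrite /L /dil mul0r mul1r add0r.
have expand t y : Es A (fun z => dil 1 t i g z ^+ 2) y =
    X y + (2 * t) * Y y + t ^+ 2 * Z y.
  rewrite -!EsZ -!EsD; congr (Es A _ y); apply/funext => z.
  by rewrite LE /dil; ring.
have X0 y : 0 <= X y by apply: Es_ge0 => // z; exact: sqr_ge0.
have Z0 y : 0 <= Z y by apply: Es_ge0 => // z; exact: sqr_ge0.
have W0 y : 0 <= W y by rewrite -(ave_cst nuP i 0 y); exact: ave_le.
have aveX : ave i X = X.
  rewrite -Es_ave; congr (Es A _); apply/funext => z.
  by rewrite (ave_mulr nu i (ave i g) g) ave_idem.
have aveY y : ave i Y y = 0.
  rewrite -Es_ave -[RHS](Es_cst nuP A 0 y).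
  congr (Es A _ y); apply/funext => z.
  rewrite ave_mulr (_ : ave i L z = 0) ?mul0r//.
  rewrite [L](_ : _ = fun y => g y + (-1) * ave i g y).
    by rewrite aveD aveZ ave_idem// mulN1r subrr.
  by apply/funext => z'; rewrite LE mulN1r.
(* [X] does not depend on coordinate [i], while [Y] has mean zero in it. *)
have EXY : E (fun y => Y y * X y) = 0.
  rewrite -aveX Etot_mul_ave -[RHS](Es_cst nuP (enum 'I_n) 0 x0).
  by congr (Es _ _ x0); apply/funext => y; rewrite aveY mul0r.
have EXZ : E (fun y => Z y * X y) = E (fun y => W y * X y).
  by rewrite -aveX Etot_mul_ave.
have EsgE y : Es (i :: A) (fun z => g z ^+ 2) y = X y + W y.
  rewrite Es_cons -[Es A _](_ : (fun y => X y + (2 * Y y + Z y)) = _).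
    by rewrite !aveD aveZ aveX aveY mulr0 add0r.
  apply/funext => z; have := expand 1 z.
  rewrite mulr1 expr1n mul1r addrA => <-; congr (Es A _ z).
  by apply/funext => z'; rewrite /dil !mul1r addrC subrK.
(* Expand the square of [X + Y + Z / 4]. The term [Y Z / 2] is at most [(Y ^+ 2 + Z ^+ 2) / 4], and
   [Y ^+ 2 <= X Z]; this gives [1/2 + 5/4 = 7/4] for [X Z] and [1/16 + 1/4 = 5/16] for [Z ^+ 2]. *)
apply: (@le_trans _ _ (E (fun y => X y ^+ 2 + (7 / 4 * (Z y * X y) +
    (5 / 16 * Z y ^+ 2 + 2 * (Y y * X y)))))).
  apply: Etot_le => y; rewrite expand.
  have YXZ : Y y ^+ 2 <= X y * Z y.
    by rewrite mulrC; exact: CauchySchwarz_Es.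
  have : 0 <= (Y y - Z y) ^+ 2 by exact: sqr_ge0.
  nra.
rewrite !(EtotD, EtotZ) EXY mulr0 addr0.
(* Against [X] the factor [Z] may be replaced by its average [W]; since [7/4 <= 2], the terms with
   [X] then fit into the square of [X + W]. *)
apply: (@le_trans _ _ (E (fun y => X y ^+ 2 + 2 * (W y * X y)) +
    E (fun y => Z y ^+ 2))).
  rewrite EtotD EtotZ -EXZ.
  have : 0 <= E (fun y => Z y * X y) by apply: Etot_ge0 => y; exact: mulr_ge0.
  have : 0 <= E (fun y => Z y ^+ 2) by apply: Etot_ge0 => y; exact: sqr_ge0.
  lra.
rewrite lerD2r; apply: Etot_le => y; rewrite EsgE.
have := sqr_ge0 (W y); nra.
Qed.

(** The recursion branches like the one-coordinate inequality. Its leaves are indexed by the subsets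
    [S] of [s], and bound the average of the square of [L_S g] over [A] and the rest of [s]. *)
Fixpoint restr_bounded eps s A g : Prop :=
  if s is i :: s' then
    restr_bounded eps s' (i :: A) g /\ restr_bounded eps s' A (dil 0 1 i g)
  else forall x, Es A (fun y => g y ^+ 2) x <= eps.

(** The sum of [E (L_S g) ^+ 2] over all subsets [S] of [s]. *)
Fixpoint laplacian_energy s g : R :=
  if s is i :: s' then
    laplacian_energy s' g + laplacian_energy s' (dil 0 1 i g)
  else E (fun y => g y ^+ 2).

(** At each leaf one of the two factors [Es A] is bounded by [eps] and the other integrates to the
    energy. *)
Lemma hypercontractive eps s A g : restr_bounded eps s A g ->
  E (fun y => Es A (fun z => noise (1 / 2) s g z ^+ 2) y ^+ 2) <=
  eps * laplacian_energy s g.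
Proof.
elim: s A g => [|i s IH] A g /=.
  move=> h; rewrite -(Etot_Es A (fun y => g y ^+ 2)) -EtotZ; apply: Etot_le => y.
  by rewrite expr2 ler_wpM2r// Es_ge0// => z; exact: sqr_ge0.
move=> [/IH h1 /IH h2]; rewrite mulrDr.
apply: le_trans (lerD h1 h2); rewrite noise_dil.
exact: hypercontractive_step.
Qed.

(** In each coordinate the Laplacian part is counted twice with weight [1/64], and [2/64 <= 1/16];
    the averaged part is counted once. *)
Lemma laplacian_energy_noise s g :
  laplacian_energy s (noise (1 / 8) s g) <=
  E (fun y => noise (1 / 4) s g y ^+ 2).
Proof.
elim: s g => // i s IH g.
rewrite /= -/(noise (1 / 8) s g) -/(noise (1 / 4) s g) dil_dil//.
rewrite -!noise_dil; apply: le_trans (lerD (IH _) (IH _)) _.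
rewrite !noise_dil (Etot_dil_sqr 1) (Etot_dil_sqr (0 * 1)) (Etot_dil_sqr 1 (1 / 4)).
set a := E _; set b := E _.
have : 0 <= b by apply: Etot_ge0 => y; exact: sqr_ge0.
lra.
Qed.

Lemma Es_noise_sqr_le (t : R) s A v x : 0 <= t <= 1 -> {subset s <= A} ->
  Es A (fun y => noise t s v y ^+ 2) x <= Es A (fun y => v y ^+ 2) x.
Proof.
move=> /andP[t0 t1]; elim: s => // i s IH sA.
apply: le_trans (IH _); last by move=> j js; apply: sA; rewrite inE js orbT.
have iA : i \in A by apply: sA; rewrite mem_head.
rewrite -[noise t (i :: s) v]/(dil 1 t i (noise t s v)).
set g := noise t s v.
(* Writing the identity as [dil 1 1 i] lets both sides be split orthogonally. *)
have {2}-> : g = dil 1 1 i g.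
  by apply/funext => y; rewrite dilE subrr mul0r addr0 mul1r.
rewrite (Es_dil_sqr nuP 1 t)// (Es_dil_sqr nuP 1 1)// lerD2l ler_wpM2r//.
  by apply: Es_ge0 => // y; exact: sqr_ge0.
by rewrite lerXn2r// nnegrE.
Qed.

(** Each factor [t L_i] splits the squared norm into a term with [i] fixed and one with [i]
    averaged, each of weight [2 t ^+ 2]; [J] collects the averaged coordinates. *)
Lemma Es_foldr_laplacian_le t f M S A x :
  (forall J, {subset J <= S} ->
     forall y, Es (J ++ A) (fun z => f z ^+ 2) y <= M) ->
  Es A (fun y => foldr (dil 0 t) f S y ^+ 2) x <= (4 * t ^+ 2) ^+ size S * M.
Proof.
elim: S A x => [|i S IH] A x h.
  by rewrite expr0 mul1r; apply: (h [::]).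
rewrite /= exprS -mulrA; set g := foldr _ _ _.
have tt : 0 <= 2 * t ^+ 2 by rewrite mulr_ge0 ?sqr_ge0.
have h1 : Es A (fun y => g y ^+ 2) x <= (4 * t ^+ 2) ^+ size S * M.
  by apply: IH => J JS; apply: h => j /JS; rewrite inE orbC => ->.
have h2 : Es (i :: A) (fun y => g y ^+ 2) x <= (4 * t ^+ 2) ^+ size S * M.
  apply: IH => J JS y; rewrite Es_cat Es_cons Es_ave -Es_cat -Es_cons.
  apply: (h (i :: J)) => j; rewrite !inE => /orP[->//|/JS ->]; exact: orbT.
have : Es A (fun y => dil 0 t i g y ^+ 2) x <=
       2 * t ^+ 2 * Es A (fun y => g y ^+ 2) x +
       2 * t ^+ 2 * Es (i :: A) (fun y => g y ^+ 2) x.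
  rewrite Es_cons -Es_ave -Es_lin; apply: Es_le => // y.
  have : ave i g y ^+ 2 <= ave i (fun z => g z ^+ 2) y.
    have := CauchySchwarz_Es nuP [:: i] g (fun=> 1) y.
    rewrite [X in _ * X](_ : _ = 1); last by rewrite expr1n Es_cst.
    rewrite mulr1 /=; apply: le_trans; rewrite le_eqVlt; apply/orP; left.
    by apply/eqP; congr (ave i _ y ^+ 2); apply/funext => z; rewrite mulr1.
  rewrite dilE => jensen.
  have sq : (g y - ave i g y) ^+ 2 <= 2 * (g y ^+ 2 + ave i (fun z => g z ^+ 2) y).
    by have := sqr_ge0 (g y + ave i g y); nra.
  have := ler_wpM2l (sqr_ge0 t) sq; lra.
have := ler_wpM2l tt h1; have := ler_wpM2l tt h2.
set c := _ ^+ size S * M; lra.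
Qed.

Lemma restr_bounded_noise eps (t : R) f :
  0 <= t <= 1 ->
  (forall A S, (forall i, (i \in A) || (i \in S)) ->
     forall x, Es A (fun y => foldr (dil 0 t) f S y ^+ 2) x <= eps) ->
  restr_bounded eps (enum 'I_n) [::] (noise t (enum 'I_n) f).
Proof.
move=> t01 h.
(* Invariant of the recursion: processed coordinates lie in [A] with their noise kept, or in [S],
   where Laplacian and noise merge into [dil 0 t]. At a leaf the noise on [A] is dropped as a
   contraction. *)
suff gen s A S : (forall i, [|| i \in s, i \in A | i \in S]) ->
    restr_bounded eps s A (noise t s (noise t A (foldr (dil 0 t) f S))).
  by apply: (gen (enum 'I_n) [::] [::]) => i; rewrite mem_enum.
elim: s A S => [|i s IH] A S cov.
  by move=> x; apply: le_trans (Es_noise_sqr_le _ _ t01 _) (h _ _ cov x).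
rewrite /= -/(noise t s _); split.
  rewrite -noise_dil; apply: (IH (i :: A) S) => j.
  by have := cov j; rewrite !inE; case: eqP; rewrite ?orbT.
rewrite dil_dil// mul0r mul1r -!noise_dil; apply: (IH A (i :: S)) => j.
by have := cov j; rewrite !inE; case: eqP; rewrite ?orbT.
Qed.

Section Indicator.
Variables (f : prodT Om -> R) (r eps : R).
Hypothesis eps_ge0 : 0 <= eps.
Hypothesis f_idem : forall x, f x ^+ 2 = f x.
Hypothesis f_global : forall A, #|[predC A]|%:R <= r ->
  forall x, Es A (fun y => f y ^+ 2) x <= eps.
Hypothesis eps_large : forall m, r < m%:R -> (1 / 16) ^+ m <= eps.

Lemma global_noise_norm4 :
  E (fun y => noise (1 / 16) (enum 'I_n) f y ^+ 4) <=
  eps * E (fun y => noise (1 / 4) (enum 'I_n) f y ^+ 2).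
Proof.
have f1 x : f x ^+ 2 <= 1.
  by rewrite f_idem; have := f_idem x; have := sqr_ge0 (f x - 1); nra.
have bnd : restr_bounded eps (enum 'I_n) [::] (noise (1 / 8) (enum 'I_n) f).
  apply: restr_bounded_noise => [|A S cov x]; first lra.
  (* Coordinates outside [J ++ A] lie in [S], so at most [size S] of them are fixed. *)
  have card J : (#|[predC (J ++ A)]| <= size S)%N.
    apply: leq_trans (card_size S); apply: subset_leq_card.
    apply/fintype.subsetP => i; rewrite !inE mem_cat negb_or => /andP[_ iA].
    by have := cov i; rewrite (negPf iA).
  have c16 : 4 * (1 / 8) ^+ 2 = 1 / 16 :> R by lra.
  (* For small [S] globalness applies; for large [S] the trivial bound [f ^+ 2 <= 1] suffices, since
     the factor [16^-|S|] is itself at most [eps]. *)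
  have [Sr|rS] := lerP (size S)%:R r.
    apply: (@le_trans _ _ ((1 / 16) ^+ size S * eps)).
      rewrite -c16; apply: Es_foldr_laplacian_le => J _ y.
      by apply: f_global; apply: le_trans Sr; rewrite ler_nat.
    by rewrite ler_piMl// exprn_ile1//; lra.
  apply: le_trans (eps_large rS); rewrite -[leRHS]mulr1 -c16.
  apply: Es_foldr_laplacian_le => J _ y.
  by rewrite -(Es_cst nuP (J ++ A) 1 y); exact: Es_le.
have := hypercontractive bnd.
rewrite noise_noise// [_ * (1 / 8)](_ : _ = 1 / 16); last by lra.
move=> h; apply: le_trans (le_trans h _).
  by apply: Etot_le => y; rewrite -exprM.
exact: ler_wpM2l (laplacian_energy_noise _ _).
Qed.

End Indicator.
End Hypercontractivity.

(** * Spectral gap of a single chain *)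

Section SpectralGap.
Variables (R : realType) (S : finType) (P : S -> S -> R) (nu : S -> R).
Implicit Types (f g : S -> R).

Lemma EvD f g : Ev nu (fun a => f a + g a) = Ev nu f + Ev nu g.
Proof. by rewrite /Ev -big_split; apply: eq_bigr => a _; rewrite mulrDr. Qed.

Lemma EvZ c f : Ev nu (fun a => c * f a) = c * Ev nu f.
Proof. by rewrite /Ev mulr_sumr; apply: eq_bigr => a _; rewrite mulrCA. Qed.

Lemma Ev_cst c : distribution nu -> Ev nu (fun=> c) = c.
Proof. by case=> _ nu1; rewrite /Ev -mulr_suml nu1 mul1r. Qed.

Lemma Ev_applyP f : stationary_dist P nu -> Ev nu (applyP P f) = Ev nu f.
Proof.
case=> _ st; rewrite /Ev /applyP.
under eq_bigr do rewrite mulr_sumr.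
rewrite exchange_big; apply: eq_bigr => b _.
by rewrite -st mulr_suml; apply: eq_bigr => a _; rewrite mulrA.
Qed.

(** Nonnegativity of the variance of [f] under row [a] of the chain. *)
Lemma applyP_sqr_le f a : markov_chain P ->
  applyP P f a ^+ 2 <= applyP P (fun b => f b ^+ 2) a.
Proof.
case=> P0 P1; set m := applyP P f a.
have : 0 <= \sum_b P a b * (f b - m) ^+ 2.
  by apply: sumr_ge0 => b _; rewrite mulr_ge0 ?sqr_ge0.
have -> : \sum_b P a b * (f b - m) ^+ 2 =
    \sum_b P a b * f b ^+ 2 + ((- 2 * m) * (\sum_b P a b * f b) +
    m ^+ 2 * \sum_b P a b).
  rewrite [m ^+ 2 * _]mulr_sumr [- 2 * m * _]mulr_sumr -!big_split.
  by apply: eq_bigr => b _ /=; ring.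
rewrite P1 -/(applyP P f a) -/m -/(applyP P (fun b => f b ^+ 2) a).
lra.
Qed.

(** The chain fixes constants and, by stationarity, keeps centred functions centred, so mean and
    fluctuation decouple. *)
Lemma spectral_gap_Ev_sqr lam f :
  markov_chain P -> stationary_dist P nu -> abs_spectral_gap_ge P nu lam ->
  Ev nu (fun a => applyP P f a ^+ 2) <=
  Ev nu f ^+ 2 + (1 - lam) ^+ 2 * Ev nu (fun a => (f a - Ev nu f) ^+ 2).
Proof.
move=> mc st [_ gap]; have [[nu0 nu1] _] := st.
set m := Ev nu f; pose g a := f a - m; set v := Ev nu (fun a => (f a - m) ^+ 2).
have Eg : Ev nu g = 0.
  by rewrite /g EvD (Ev_cst (- m)) ?subrr//; exact: st.1.
have Pf a : applyP P f a = m + applyP P g a.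
  rewrite /applyP /g; under [X in _ = _ + X]eq_bigr do rewrite mulrBr.
  by rewrite sumrB -mulr_suml mc.2 mul1r addrC subrK.
have -> : Ev nu (fun a => applyP P f a ^+ 2) =
    m ^+ 2 + Ev nu (fun a => applyP P g a ^+ 2).
  rewrite -[X in X + _](Ev_cst _ st.1).
  have <- : Ev nu (fun a => m ^+ 2 + 2 * m * applyP P g a) = Ev nu (fun=> m ^+ 2).
    by rewrite EvD EvZ Ev_applyP// Eg mulr0 addr0.
  by rewrite -EvD; congr Ev; apply/funext => a; rewrite Pf; ring.
rewrite lerD2l.
have v0 : 0 <= v by apply: sumr_ge0 => a _; rewrite mulr_ge0 ?sqr_ge0.
(* Zero variance rules out normalising [g]; Jensen and stationarity then bound the left side by [v]
   itself. *)
have [v_le0|v_gt0] := lerP v 0.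
  have ve : v = 0 by apply/le_anti; rewrite v_le0.
  rewrite ve mulr0 -ve /v -[leRHS]Ev_applyP//.
  by apply: ler_sum => a _; rewrite ler_wpM2l//; exact: applyP_sqr_le.
pose c := (Num.sqrt v)^-1.
have cv : c ^+ 2 * v = 1 by rewrite exprVn sqr_sqrtr// mulVf ?gt_eqF.
have : ((Ev nu (fun a => applyP P (fun b => c * g b) a ^+ 2))%:E <=
        ((1 - lam) ^+ 2)%:E)%E.
  apply: le_trans gap; apply: ereal_sup_ubound.
  exists (fun b => c * g b) => //; split; first by rewrite EvZ Eg mulr0.
  rewrite -cv -EvZ; congr Ev; apply/funext => b; exact: exprMn.
rewrite lee_fin (_ : Ev _ _ = c ^+ 2 * Ev nu (fun a => applyP P g a ^+ 2)).
  by rewrite -(ler_pM2r v_gt0) mulrAC cv mul1r.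
rewrite -EvZ; congr Ev; apply/funext => a.
rewrite -exprMn; congr (_ ^+ 2); rewrite /applyP mulr_sumr.
by apply: eq_bigr => b _; rewrite mulrCA.
Qed.

End SpectralGap.

(** * Comparison of the product chain with noise *)

Section ProductChain.
Variables (R : realType) (n : nat) (Om : 'I_n -> finType).
Variables (T : forall i, Om i -> Om i -> R) (nu : forall i, Om i -> R).
Hypothesis Tmc : forall i, markov_chain (@T i).
Hypothesis Tst : forall i, stationary_dist (@T i) (@nu i).
Variable x0 : prodT Om.
Implicit Types (u v f g : prodT Om -> R) (x w : prodT Om) (i j : 'I_n).
Implicit Types (s A : seq 'I_n).

Let nuP i : distribution (@nu i) := (Tst i).1.
Local Notation E := (Etot nu x0).

Lemma kop_dil a b i j u : i != j ->
  kop T j (dil nu a b i u) = dil nu a b i (kop T j u).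
Proof.
move=> ij; apply/funext => x.
rewrite dilE ave_kop -(kopC T _ u (i := j)) 1?eq_sym// -ave_kop /kop.
rewrite !mulr_sumr -big_split; apply: eq_bigr => d _ /=.
by rewrite dilE; ring.
Qed.

Lemma foldr_kop_dil a b i s u : i \notin s ->
  foldr (kop T) (dil nu a b i u) s = dil nu a b i (foldr (kop T) u s).
Proof.
elim: s => //= j s IH; rewrite inE negb_or => /andP[ij /IH->].
exact: kop_dil.
Qed.

(** With the other coordinates frozen this is the spectral gap bound for [T i], whose right side is
    exactly the squared norm after one noise factor. *)
Lemma Etot_kop_sqr_le lam i u : abs_spectral_gap_ge (@T i) (@nu i) lam ->
  E (fun y => kop T i u y ^+ 2) <= E (fun y => dil nu 1 (1 - lam) i u y ^+ 2).
Proof.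
move=> gap; rewrite -(Etot_ave nuP x0 i) -[leRHS](Etot_ave nuP x0 i).
apply: Etot_le => // x.
pose phi (b : Om i) := u (upd x b).
have -> : ave nu i (fun y => kop T i u y ^+ 2) x =
    Ev (@nu i) (fun a => applyP (@T i) phi a ^+ 2).
  apply: eq_bigr => b _; congr (_ * _ ^+ 2).
  by apply: eq_bigr => d _; rewrite upd_in updK.
apply: le_trans (spectral_gap_Ev_sqr phi (Tmc i) (Tst i) gap) _.
set m := Ev _ phi.
have -> : ave nu i (fun y => dil nu 1 (1 - lam) i u y ^+ 2) x =
    Ev (@nu i) (fun a => m ^+ 2 + (2 * m * (1 - lam) * (phi a - m) +
      (1 - lam) ^+ 2 * (phi a - m) ^+ 2)).
  apply: eq_bigr => b _; congr (_ * _).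
  rewrite /dil ave_upd -/(phi b) -[ave nu i u x]/m; ring.
by rewrite !EvD !EvZ !Ev_cst// EvD Ev_cst// subrr mulr0 add0r.
Qed.

(** Chain steps are traded for noise factors one at a time; a new factor on [i] commutes past the
    steps left in [s], as [i] is not in [s]. *)
Lemma Etot_prod_chain_sqr_le lam s u :
  (forall i, abs_spectral_gap_ge (@T i) (@nu i) lam) -> uniq s ->
  E (fun y => foldr (kop T) u s y ^+ 2) <=
  E (fun y => noise nu (1 - lam) s u y ^+ 2).
Proof.
move=> gap; elim: s u => // i s IH u /= /andP[is_ us].
apply: le_trans (Etot_kop_sqr_le _ (gap i)) _.
rewrite -foldr_kop_dil//; apply: le_trans (IH _ us) _.
by rewrite noise_dil.
Qed.

Lemma EtotE u : E u = \sum_w prod_dist nu w * u w.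
Proof.
rewrite /Etot /Es -[foldr _ _ _]/(foldr (kop (fun j _ => @nu j)) u (enum 'I_n)).
rewrite foldr_kopE ?enum_uniq//; apply: eq_big => [w|w _].
  by apply/forallP => i; rewrite mem_enum.
by rewrite /prod_dist big_enum.
Qed.

Lemma prod_chainE u x :
  foldr (kop T) u (enum 'I_n) x = \sum_y prod_chain T x y * u y.
Proof.
rewrite foldr_kopE ?enum_uniq//; apply: eq_big => [w|w _].
  by apply/forallP => i; rewrite mem_enum.
by rewrite /prod_chain big_enum.
Qed.

Lemma edge_probE (F : {set prodT Om}) :
  edge_prob T nu F =
  E (fun x => indic R F x * foldr (kop T) (indic R F) (enum 'I_n) x).
Proof.
rewrite EtotE /edge_prob big_mkcond; apply: eq_bigr => x _.
rewrite prod_chainE /indic; case: ifP => xF; rewrite ?mul0r ?mulr0// mul1r.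
rewrite mulr_sumr big_mkcond; apply: eq_bigr => y _.
by case: ifP => yF; rewrite ?mulr0 ?mulr1.
Qed.

(** Fixing the complement of [A] means averaging over [A]; repetitions in the list are removed by
    idempotence. *)
Lemma restr_sqnormE A f x :
  restr_sqnorm nu [set i | i \notin A] x f = Es nu A (fun y => f y ^+ 2) x.
Proof.
rewrite -(Es_undup nuP).
rewrite /Es -[foldr _ _ _]/(foldr (kop (fun j _ => @nu j)) _ (undup A)).
rewrite foldr_kopE ?undup_uniq//; apply: eq_big => [w|w _].
  by apply: eq_forallb => i; rewrite inE mem_undup.
rewrite big_uniq ?undup_uniq//=; congr (_ * _).
by apply: eq_bigl => i; rewrite inE negbK mem_undup.
Qed.

End ProductChain.

(** * Small-set bounds for noise applied to a global indicator *)

Section SmallSet.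
Variables (R : realType) (n : nat) (Om : 'I_n -> finType).
Variables (nu : forall i, Om i -> R).
Hypothesis nuP : forall i, distribution (@nu i).
Variables (x0 : prodT Om) (f : prodT Om -> R) (r eps : R).
Hypothesis eps_gt0 : 0 < eps.
Hypothesis f_idem : forall x, f x ^+ 2 = f x.
Hypothesis r_ge0 : 0 <= r.
Hypothesis f_global : forall A : seq 'I_n, #|[predC A]|%:R <= r ->
  forall x, Es nu A (fun y => f y ^+ 2) x <= eps.
Hypothesis eps_large : forall m, r < m%:R -> (1 / 16) ^+ m <= eps.

Local Notation E := (Etot nu x0).
Local Notation D t := (E (fun y => noise nu t (enum 'I_n) f y ^+ 2)).

Lemma Etot_CauchySchwarz u v :
  E (fun y => u y * v y) ^+ 2 <= E (fun y => u y ^+ 2) * E (fun y => v y ^+ 2).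
Proof. exact: CauchySchwarz_Es. Qed.

Lemma Etot_sqr_ge0 u : 0 <= E (fun y => u y ^+ 2).
Proof. by apply: Etot_ge0 => // y; exact: sqr_ge0. Qed.

Lemma global_mean_le : E (fun y => f y ^+ 2) <= eps.
Proof.
apply: f_global; rewrite eq_card0// => i.
by rewrite !inE mem_enum.
Qed.

Lemma noise_interpolation t : D t ^+ 2 <= eps * D (t * t).
Proof.
rewrite {1}Etot_noise_sqr//; apply: le_trans (Etot_CauchySchwarz _ _) _.
by rewrite ler_wpM2r ?Etot_sqr_ge0 ?global_mean_le.
Qed.

Lemma noise_quarter_le : D (1 / 4) <= eps `^ (4 / 3).
Proof.
set V := D (1 / 4); set B := E (fun y => f y ^+ 2).
pose g := noise nu (1 / 16) (enum 'I_n) f.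
have B0 : 0 <= B := Etot_sqr_ge0 _.
have V0 : 0 <= V := Etot_sqr_ge0 _.
have Be : B <= eps := global_mean_le.
have g4 : E (fun y => g y ^+ 4) <= eps * V.
  exact: (global_noise_norm4 nuP x0 (ltW eps_gt0) f_idem f_global eps_large).
(* Hoelder is done by two applications of Cauchy-Schwarz. Since [f = f ^+ 2], a copy of [f] stays
   beside [g] and yields a second factor [B], whence [V ^+ 4 <= B ^+ 3 * (eps * V)]. *)
have V2 : V ^+ 2 <= B * E (fun y => f y * g y ^+ 2).
  rewrite /V Etot_noise_sqr// (_ : 1 / 4 * (1 / 4) = 1 / 16); last by lra.
  rewrite (_ : (fun y => _) = fun y => f y * (f y * g y)); last first.
    by apply/funext => y; rewrite mulrA -expr2 f_idem.
  apply: le_trans (Etot_CauchySchwarz _ _) _.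
  rewrite (_ : (fun y => (f y * g y) ^+ 2) = fun y => f y * g y ^+ 2)//.
  by apply/funext => y; rewrite exprMn f_idem.
have V4 : V ^+ 4 <= eps ^+ 4 * V.
  set C := E _ in V2.
  have C2 : C ^+ 2 <= B * (eps * V).
    apply: le_trans (Etot_CauchySchwarz _ _) _; rewrite ler_wpM2l//.
    by apply: le_trans g4; apply: Etot_le => // y; rewrite -exprM.
  have C0 : 0 <= C.
    by apply: Etot_ge0 => // y; rewrite -f_idem -exprMn sqr_ge0.
  apply: (@le_trans _ _ ((B * C) ^+ 2)).
    by rewrite (exprM V 2 2) lerXn2r// ?nnegrE ?sqr_ge0// mulr_ge0.
  rewrite exprMn; apply: le_trans (ler_wpM2l (sqr_ge0 B) C2) _.
  rewrite (_ : B ^+ 2 * _ = B ^+ 3 * (eps * V)); last by ring.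
  rewrite [eps ^+ 4]exprSr -mulrA ler_wpM2r ?mulr_ge0 ?(ltW eps_gt0)//.
  by rewrite lerXn2r// nnegrE ltW.
have [V_le0|V_gt0] := lerP V 0; first exact: le_trans (powR_ge0 _ _).
rewrite -(@ler_pXn2r _ 3)// ?nnegrE ?powR_ge0//.
rewrite -[leRHS]powR_mulrn ?powR_ge0// -powRrM.
rewrite (_ : 4 / 3 * 3%:R = 4%:R); last by lra.
rewrite powR_mulrn ?(ltW eps_gt0)// -(ler_pM2r V_gt0).
by rewrite -exprSr.
Qed.

(** Each passage from [t * t] back to [t] takes a square root and halves the gain in the exponent,
    starting from [1/3] at noise [1/4]. *)
Lemma noise_le k (t : R) : 0 <= t -> t ^+ (2 ^ k) <= 1 / 4 ->
  D t <= eps `^ (1 + 1 / 3 / 2 ^+ k).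
Proof.
elim: k t => [|k IH] t t0 tk.
  rewrite expr0 divr1 (_ : 1 + _ = 4 / 3); last by lra.
  apply: le_trans noise_quarter_le; apply: noise_sqr_mono => //.
  by rewrite t0.
rewrite -(@ler_pXn2r _ 2)// ?nnegrE ?powR_ge0 ?Etot_sqr_ge0//.
apply: le_trans (noise_interpolation t) _.
have := IH (t * t) (mulr_ge0 t0 t0).
rewrite -expr2 -exprM -expnS => /(_ tk) h.
apply: le_trans (ler_wpM2l (ltW eps_gt0) h) _.
rewrite -[X in X * _]powRr1 ?(ltW eps_gt0)// -powRD; last first.
  by rewrite gt_eqF// implybT.
rewrite -[leRHS]powR_mulrn ?powR_ge0// -powRrM.
suff -> : 1 + (1 + 1 / 3 / 2 ^+ k) = (1 + 1 / 3 / 2 ^+ k.+1) * 2%:R :> R by [].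
rewrite exprS; field; exact: expf_neq0.
Qed.

End SmallSet.

(** * Choice of constants and conclusion *)

Lemma exists_iterated_square_le (R : realType) (lam : R) :
  0 < lam -> exists k, Num.max 0 (1 - lam) ^+ (2 ^ k) <= 1 / 4.
Proof.
move=> lam0; set t := Num.max _ _.
have t0 : 0 <= t by rewrite le_max lexx.
have te : t <= expR (- lam) by rewrite ge_max expR_ge0/= expR_ge1Dx.
(* This makes [2 ^ k * lam >= 3], and [expR 3 >= 1 + 3 = 4]. *)
pose k := Num.bound (3 / lam); exists k.
have k3 : 3 <= k%:R * lam.
  rewrite -ler_pdivrMr//; apply/ltW/archi_boundP.
  by rewrite divr_ge0// ltW.
have k2 : 3 <= (2 ^ k)%:R * lam.
  by apply: le_trans k3 _; rewrite ler_pM2r// ler_nat ltnW// ltn_expl.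
apply: (@le_trans _ _ (expR (- lam) ^+ (2 ^ k))).
  by rewrite lerXn2r// nnegrE expR_ge0.
rewrite -expRM_natl mulrN expRN div1r lef_pV2 ?posrE ?expR_gt0//.
apply: le_trans (expR_ge1Dx _); lra.
Qed.

Lemma expr_le_of_ln_lt (R : realType) (mu : R) m :
  0 < mu -> ln (1 / mu) < m%:R -> (1 / 16) ^+ m <= mu.
Proof.
move=> mu0; rewrite div1r lnV// => lt_m.
have e16 : 1 / 16 <= expR (-1) :> R.
  rewrite (_ : -1 = 2%:R * - (1 / 2)); last by lra.
  have := expR_ge1Dx (- (1 / 2) : R); rewrite expRM_natl; nra.
apply: (@le_trans _ _ (expR (-1) ^+ m)).
  by rewrite lerXn2r// ?nnegrE ?expR_ge0//; lra.
rewrite -expRM_natl mulrN1 -[leRHS]lnK// ler_expR; lra.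
Qed.

Theorem theorem5p3 (R : realType) (lam : R) (hlam : 0 < lam) :
  exists c : R, 0 < c /\
    forall (n : nat) (Om : 'I_n -> finType)
      (T : forall i, Om i -> Om i -> R) (nu : forall i, Om i -> R),
      (forall i, markov_chain (T i)) ->
      (forall i, stationary_dist (T i) (nu i)) ->
      (forall i, abs_spectral_gap_ge (T i) (nu i) lam) ->
      forall (F : {set prodT Om}) (mu : R),
        0 < mu < 1 / 16 ->
        is_global nu (ln (1 / mu)) (mu `^ (1 - c)) (@indic R n Om F) ->
        edge_prob T nu F <= mu `^ (1 + c).
Proof.
have [k hk] := exists_iterated_square_le hlam.
set t := Num.max _ _ in hk.
have t0 : 0 <= t by rewrite le_max lexx.
(* Half of the gain for noise [t], because Cauchy-Schwarz bounds the square of the edge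
   probability. *)
pose eta : R := 1 / 3 / 2 ^+ k.+1.
have eta_gt0 : 0 < eta by rewrite !divr_gt0 ?exprn_gt0.
have eta_le1 : eta <= 1.
  have : 1 <= 2 ^+ k.+1 :> R by apply: exprn_ege1; rewrite ler1n.
  by move=> h; rewrite /eta ler_pdivrMr ?exprn_gt0// mul1r; lra.
(* With [eta = 3 c], [(1 - c) (1 + eta) = 1 + 2 c - 3 c ^+ 2], which is at least [1 + c] because
   [c <= 1/3]. *)
exists (eta / 3); split; first by rewrite divr_gt0.
move=> n Om T nu Tmc Tst gap F mu /andP[mu0 mu16] glob.
set c := eta / 3 in glob *.
(* A point of [F] serves as the base point of [Etot]. *)
have [->|[x0 _]] := set_0Vmem F.
  by rewrite /edge_prob big_set0 powR_ge0.
have nuP i : distribution (nu i) := (Tst i).1.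
set eps := mu `^ (1 - c) in glob.
have eps_gt0 : 0 < eps by exact: powR_gt0.
have mu_eps : mu <= eps.
  rewrite -{1}[mu]powRr1 ?(ltW mu0)//; apply: ger_powR; first by rewrite mu0; lra.
  by rewrite /c; lra.
set f := indic R F in glob.
have f_idem x : f x ^+ 2 = f x.
  by rewrite /f /indic; case: (x \in F); rewrite ?expr1n ?expr0n.
have f_global (A : seq 'I_n) : #|[predC A]|%:R <= ln (1 / mu) ->
    forall x, Es nu A (fun y => f y ^+ 2) x <= eps.
  move=> hA x; rewrite -(restr_sqnormE Tst); apply: glob.
  by rewrite cardsE.
have eps_large m : ln (1 / mu) < m%:R -> (1 / 16) ^+ m <= eps.
  by move=> /(expr_le_of_ln_lt mu0) h; exact: le_trans mu_eps.
have r0 : 0 <= ln (1 / mu) by rewrite ln_ge0// ler_pdivlMr//; lra.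
rewrite (edge_probE _ _ x0).
set P := Etot _ _ _.
have P2 : P ^+ 2 <= eps * eps `^ (1 + 1 / 3 / 2 ^+ k).
  apply: le_trans (CauchySchwarz_Es nuP _ _ _ _) _.
  apply: ler_pM; [exact: Etot_sqr_ge0|exact: Etot_sqr_ge0| |].
    exact: (global_mean_le x0 r0 f_global).
  apply: le_trans (noise_le nuP x0 eps_gt0 f_idem r0 f_global eps_large t0 hk).
  apply: le_trans (Etot_prod_chain_sqr_le Tmc Tst x0 _ gap (enum_uniq _)) _.
  (* Any coordinate supplies [0 <= 1 - lam], as monotonicity requires; for [n = 0] both noise
     operators are the identity. *)
  have [i _|noi] := pickP (fun i : 'I_n => true).
    by apply: noise_sqr_mono => //; rewrite (gap i).1/= le_max lexx orbT.
  by case: (enum 'I_n) => // i ?; have := noi i.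
have Pe : P <= eps `^ (1 + eta).
  have [P_le0|P_gt0] := lerP P 0; first exact: le_trans (powR_ge0 _ _).
  rewrite -(@ler_pXn2r _ 2)// ?nnegrE ?powR_ge0 ?(ltW P_gt0)//.
  apply: le_trans P2 _.
  rewrite -[X in X * _]powRr1 ?(ltW eps_gt0)// -powRD; last first.
    by rewrite gt_eqF// implybT.
  rewrite -[leRHS]powR_mulrn ?powR_ge0// -powRrM /eta exprS.
  suff -> : 1 + (1 + 1 / 3 / 2 ^+ k) = (1 + 1 / 3 / (2 * 2 ^+ k)) * 2%:R :> R by [].
  field; exact: expf_neq0.
apply: le_trans Pe _; rewrite -powRrM; apply: ger_powR.
  by rewrite mu0; lra.
rewrite /c; nra.
Qed.
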